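(* Let $n,k,\ell$ be integers with $n\ge k$, $k-1>\ell>1$ and $\ell> n-k$. If $G$ is an $n$-vertex $k$-chromatic $\ell$-connected graph, then \[ |E(G)|\geq \binom{k}{2}+\binom{n-k}{2}+(n-k)\bigl(\ell-(n-k-1)\bigr), \] and this bound is sharp, in the sense that for all such $n,k,\ell$ there exists an $n$-vertex $k$-chromatic $\ell$-connected graph attaining equality.
   Context: All graphs are finite and simple. A graph is $k$-chromatic if its chromatic number is exactly $k$. A graph $G$ is $\ell$-connected if $|V(G)|>\ell$ and any graph obtained by deleting fewer than $\ell$ vertices is connected. $E(G)$ is the edge set of $G$. By convention $\binom{0}{2}=\binom{1}{2}=0$. *)

(* Defs.v *)
From mathcomp Require Import all_boot.

Set Implicit Arguments.
Unset Strict Implicit.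
Unset Printing Implicit Defensive.

Record sgraph := SGraph {
  vertex :> finType;
  adj : rel vertex;
  adj_sym : symmetric adj;
  adj_irrefl : irreflexive adj }.

Definition edges (G : sgraph) : {set {set G}} :=
  [set A : {set G} | [exists x, exists y, adj x y && (A == [set x; y])]].

Definition proper_coloring (G : sgraph) (c : nat) (f : {ffun G -> 'I_c}) : bool :=
  [forall x, forall y, adj x y ==> (f x != f y)].

Definition colorable (G : sgraph) (c : nat) : bool :=
  [exists f : {ffun G -> 'I_c}, proper_coloring f].

Fact colorable_card (G : sgraph) : exists c, colorable G c.
Proof.
exists #|G|; apply/existsP; exists [ffun x => enum_rank x].
apply/forallP => x; apply/forallP => y; apply/implyP => xy.
rewrite !ffunE (inj_eq enum_rank_inj).
by apply: contraTneq xy => ->; rewrite adj_irrefl.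
Qed.

Definition chromatic_number (G : sgraph) : nat := ex_minn (colorable_card G).

Section DeleteVertices.
Variables (G : sgraph) (S : {set G}).

Definition del_adj : rel {x : G | x \notin S} := fun x y => adj (val x) (val y).

Fact del_adj_sym : symmetric del_adj.
Proof. by move=> x y; apply: adj_sym. Qed.

Fact del_adj_irrefl : irreflexive del_adj.
Proof. by move=> x; apply: adj_irrefl. Qed.

Definition del_vertices : sgraph := SGraph del_adj_sym del_adj_irrefl.

End DeleteVertices.

(* The empty graph counts as connected here; this is immaterial for
   [vertex_connected], where fewer than l of more than l vertices are deleted. *)
Definition connected (G : sgraph) : Prop :=
  forall x y : G, connect (@adj G) x y.

Definition vertex_connected (l : nat) (G : sgraph) : Prop :=
  l < #|G| /\ forall S : {set G}, #|S| < l -> connected (del_vertices S).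

(* Main.v *)
Require Import Defs.
From mathcomp Require Import all_boot zify.

Set Implicit Arguments.
Unset Strict Implicit.
Unset Printing Implicit Defensive.

(** Write n = k + m and pass to the complement H of G.  In an l-connected graph
    every degree is at least l, so H has maximum degree at most d = n - 1 - l,
    and the hypothesis l < k - 1 says that m < d.  Counting pairs of vertices,
    the lower bound on the edges of G becomes the upper bound e(H) <= m d.

    Choose W minimal among the sets of vertices that induce a subgraph of G
    which is not (k-1)-colourable, and write |W| = k + m'.  The m - m' vertices
    outside W meet at most (m - m') d edges of H, so it remains to see that
    e(H[W]) <= m' d, for which e(H[W]) <= m' (m' + 1) is enough.  Two facts
    about W give this:
    - by minimality every vertex of W has a G-neighbour in each of the k - 1
      colour classes of the rest, hence H[W] has maximum degree at most m'
      ([critical_degree]);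
    - giving a common colour to the two ends of each edge of a matching of H[W]
      colours W, hence these matchings have at most m' edges
      ([matching_colorable]).

    So all depends on the inequality e <= nu (Delta + 1) between the number of
    edges, the matching number and the maximum degree ([degree_sum_matching]).
    Vizing's theorem implies it, but it also follows from Gallai's exchange
    argument.  Delete, one at a time, vertices whose deletion lowers nu: each
    costs at most Delta edges.  When none is left, every vertex is missed by
    some maximum matching; then, for a maximum matching M, the vertices missed
    by M are independent and no two of them have a common neighbour
    ([exposed_no_common_neighbor]).  Their neighbourhoods are therefore disjoint
    subsets of the 2 nu vertices covered by M, so their degrees add up to at
    most 2 nu, while the covered vertices contribute at most 2 nu Delta.

    For sharpness, take disjoint cliques on k and m vertices, and join the i-th
    vertex of the small clique to l - m common vertices of the large clique and
    to one further private vertex.  These private edges provide, together with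
    the common neighbours, l internally disjoint paths from any vertex of the
    small clique to the large one. *)

(** * Degree sums *)

Section DegreeSums.
Variables (V : finType) (r : rel V).
Implicit Types (W : {set V}) (x y : V).

Definition degree_in W x := \sum_(y in W) (r x y : nat).
Definition degree_sum W := \sum_(x in W) degree_in W x.

Lemma degree_inE W x : degree_in W x = #|[set y in W | r x y]|.
Proof.
rewrite /degree_in -sum1_card big_mkcond [RHS]big_mkcond /=.
by apply: eq_bigr => y _; rewrite inE; case: (y \in W); case: (r x y).
Qed.

Lemma degree_in_sub W W' x : W' \subset W -> degree_in W' x <= degree_in W x.
Proof.
move=> sW; rewrite !degree_inE subset_leq_card //.
by apply/subsetP => y; rewrite !inE => /andP[/(subsetP sW)-> ->].
Qed.

Lemma degree_sumT : degree_sum [set: V] = \sum_x \sum_y (r x y : nat).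
Proof.
apply: eq_big => x; rewrite ?inE // => _.
by apply: eq_bigl => y; rewrite inE.
Qed.

Hypothesis r_sym : symmetric r.

(** An edge of [W] outside [W'] has an end in [W :\: W'], and the degree sum
    counts each edge twice. *)
Lemma degree_sum_sub W W' d : W' \subset W ->
    {in W, forall x, degree_in W x <= d} ->
  degree_sum W <= degree_sum W' + (#|W :\: W'| * d).*2.
Proof.
move=> sW dW; set U := W :\: W'.
have splitW F : \sum_(x in W) F x = \sum_(x in W') F x + \sum_(x in U) F x.
  by rewrite (big_setID W') /= (setIidPr sW).
have dU : \sum_(x in U) degree_in W x <= #|U| * d.
  rewrite -sum_nat_const; apply: leq_sum => x.
  by rewrite inE => /andP[_]; apply: dW.
(* The edges between W' and U, counted from either side. *)
have cross : \sum_(x in W') degree_in U x <= \sum_(x in U) degree_in W x.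
  rewrite /degree_in exchange_big /=; apply: leq_sum => x _.
  rewrite splitW; apply: leq_trans (leq_addr _ _).
  by apply: leq_sum => y _; rewrite r_sym.
rewrite /degree_sum splitW.
have -> : \sum_(x in W') degree_in W x =
          \sum_(x in W') degree_in W' x + \sum_(x in W') degree_in U x.
  by rewrite -big_split; apply: eq_bigr => x _; rewrite /degree_in splitW.
lia.
Qed.

End DegreeSums.

(** * Matchings and Gallai's exchange argument *)

Section Matchings.
Variables (V : finType) (r : rel V).
Hypotheses (r_sym : symmetric r) (r_irr : irreflexive r).
Implicit Types (W : {set V}) (f M N : {ffun V -> V}) (x y : V).

(** A matching is encoded as the involution that swaps the two ends of each of
    its edges and fixes the other vertices. *)
Definition matching W f :=
  [forall x, (f (f x) == x) && ((f x != x) ==> (x \in W) && r x (f x))].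

Definition covered f := [set x | f x != x].

Lemma matchingP W f :
  reflect (involutive f /\ forall x, f x != x -> x \in W /\ r x (f x))
          (matching W f).
Proof.
apply: (iffP forallP) => [m | [fK fr] x].
  split=> x; first by case/andP: (m x) => /eqP.
  by move=> nfx; case/andP: (m x) => _; rewrite nfx /= => /andP.
by rewrite fK eqxx /=; apply/implyP => /fr[-> ->].
Qed.

Lemma matchingS W W' f : W' \subset W -> matching W' f -> matching W f.
Proof.
move=> sW /matchingP[fK fr]; apply/matchingP; split=> // x /fr[xW' ->].
by rewrite (subsetP sW).
Qed.

(** One end of each matching edge, namely the one that comes later in the
    enumeration of [V]; hence [#|followers f|] is the number of edges. *)
Definition followers f := [set x | enum_rank (f x) < enum_rank x].

Lemma card_covered W f : matching W f -> #|covered f| = #|followers f|.*2.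
Proof.
move=> /matchingP[fK _].
have f_inj : injective f := inv_inj fK.
have im x : (x \in f @: followers f) = (enum_rank x < enum_rank (f x)).
  by rewrite -{1}(fK x) (mem_imset _ _ f_inj) inE fK.
have -> : covered f = followers f :|: f @: followers f.
  apply/setP => x; rewrite !inE im -neq_ltn.
  by rewrite (inj_eq val_inj) (inj_eq enum_rank_inj).
rewrite cardsU (card_imset _ f_inj) (_ : _ :&: _ = set0) ?cards0; first lia.
by apply/setP => x; rewrite !inE im; case: ltngtP.
Qed.

(** Adds the edge [xy] at a vertex [x] missed by [f], after removing the edge
    of [f] at [y], if there is one. *)
Definition rematch f x y :=
  [ffun w => if w == x then y else if w == y then x
             else if w == f y then w else f w].

Lemma rematch_matching W f x y : matching W f -> f x = x ->
  x \in W -> y \in W -> r x y -> matching W (rematch f x y).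
Proof.
move=> /matchingP[fK fr] fx xW yW rxy.
have xy : x != y by apply: contraTneq rxy => ->; rewrite r_irr.
apply/matchingP; split=> w; rewrite !ffunE.
  case: (eqVneq w x) => [->|wx]; first by rewrite eq_sym (negPf xy) eqxx.
  case: (eqVneq w y) => [->|wy]; first by rewrite eqxx.
  case: (eqVneq w (f y)) => [wfy|wfy].
    by rewrite (negPf wx) (negPf wy) -wfy eqxx.
  have -> : (f w == x) = false.
    by apply: contraNF wx => /eqP fwx; rewrite -(fK w) fwx fx.
  have -> : (f w == y) = false.
    by apply: contraNF wfy => /eqP <-; rewrite fK.
  by rewrite (inj_eq (inv_inj fK)) (negPf wy).
case: (eqVneq w x) => [-> //|wx].
case: (eqVneq w y) => [->|wy]; first by rewrite r_sym.
by case: (eqVneq w (f y)) => [_|_ /fr //]; rewrite eqxx.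
Qed.

Lemma covered_rematch W f x y : matching W f -> f x = x -> x != y -> f y != y ->
  covered (rematch f x y) = x |: (covered f :\ f y).
Proof.
move=> /matchingP[fK _] fx xy fy; apply/setP => w; rewrite !inE ffunE.
case: (eqVneq w x) => [->|wx] /=; first by rewrite eq_sym.
case: (eqVneq w y) => [->|wy]; first by rewrite xy -[y == f y]eq_sym fy.
by case: (eqVneq w (f y)) => [_|//]; rewrite eqxx.
Qed.

Lemma covered_rematch_exposed f x y : f x = x -> x != y -> f y = y ->
  covered (rematch f x y) = x |: (y |: covered f).
Proof.
move=> fx xy fy; apply/setP => w; rewrite !inE ffunE fy.
case: (eqVneq w x) => [->|wx] /=; first by rewrite eq_sym.
by case: (eqVneq w y) => [->|wy].
Qed.

Section Maximum.
Variables (W : {set V}) (s : nat).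
Hypothesis max_s : forall f, matching W f -> #|covered f| <= s.

Lemma exposed_nonadjacent M x y : matching W M -> #|covered M| = s ->
  x \in W -> y \in W -> r x y -> M x = x -> M y != y.
Proof.
move=> mM cM xW yW rxy Mx; apply/eqP => My.
have xy : x != y by apply: contraTneq rxy => ->; rewrite r_irr.
have := max_s (rematch_matching mM Mx xW yW rxy).
rewrite (covered_rematch_exposed Mx xy My) !cardsU1 !inE.
rewrite My Mx !eqxx (negPf xy) /= cM.
by rewrite add1n add1n ltnNge leqW.
Qed.

(** The heart of Gallai's lemma.  Among the maximum matchings [N] that miss
    [t], one can always increase the agreement with [M] if [M] misses both
    neighbours [u] and [v] of [t]: a contradiction.  Indeed [N] covers [u] and
    [v], so, both matchings being of the same size, some [x] other than [t] is
    covered by [M] and missed by [N]; let [N] take over the edge of [M] at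
    [x]. *)
Lemma exposed_no_common_neighbor M N t u v :
    matching W M -> #|covered M| = s -> matching W N -> #|covered N| = s ->
    t \in W -> u \in W -> v \in W -> r t u -> r t v -> u != v ->
    N t = t -> M u = u -> M v != v.
Proof.
move=> mM cM mN cN tW uW vW rtu rtv uv Nt Mu; apply/eqP => Mv.
(* Induction on the number of vertices where M and N disagree. *)
have [d] := ubnP #|[set w | M w != N w]|.
elim: d => // d IH in N mN cN Nt *; rewrite ltnS => dN.
have Nu : N u != u := exposed_nonadjacent mN cN tW uW rtu Nt.
have Nv : N v != v := exposed_nonadjacent mN cN tW vW rtv Nt.
have rut : r u t by rewrite r_sym.
have Mt : M t != t := exposed_nonadjacent mM cM uW tW rut Mu.
have [x /and3P[xt Mx /eqP Nx]] : exists x, [&& x != t, M x != x & N x == x].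
  apply/existsP; apply: contraT => /existsPn no_x.
  (* Otherwise M would cover fewer vertices than N: it misses u and v. *)
  have sub : covered M :\ t \subset covered N :\ u :\ v.
    apply/subsetP => x; rewrite !inE => /andP[xt Mx].
    have := no_x x; rewrite xt Mx /= => ->; rewrite andbT.
    by apply/andP; split; apply: contraNneq Mx => ->; rewrite ?Mu ?Mv.
  have := subset_leq_card sub.
  have := cardsD1 t (covered M); have := cardsD1 u (covered N).
  have := cardsD1 v (covered N :\ u).
  rewrite !inE Mt Nu Nv eq_sym uv cM cN /=; lia.
have [/matchingP[MK Mr] /matchingP[NK Nr]] := (mM, mN).
have [xW rxy] := Mr x Mx; set y := M x in Mx rxy.
have [yW _] : y \in W /\ r y (M y) by apply: Mr; rewrite MK eq_sym.
have xy : x != y by rewrite eq_sym.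
have Ny : N y != y := exposed_nonadjacent mN cN xW yW rxy Nx.
have xNy : x != N y by apply: contraNneq xy => xNy; rewrite -Nx xNy NK.
apply: (IH (rematch N x y)).
- exact: rematch_matching.
- rewrite (covered_rematch mN Nx xy Ny) cardsU1 !inE xNy Nx eqxx /=.
  by rewrite -cN (cardsD1 (N y) (covered N)) inE NK eq_sym Ny.
- rewrite ffunE eq_sym (negPf xt).
  have ty : t != y by apply: contraNneq Ny => <-; rewrite Nt.
  by rewrite (negPf ty) Nt; case: ifP.
- apply: leq_trans dN; apply: proper_card; apply/properP; split.
    apply/subsetP => w; rewrite !inE ffunE.
    case: (eqVneq w x) => [->|wx]; first by rewrite eqxx.
    case: (eqVneq w y) => [->|wy]; first by rewrite MK eqxx.
    case: (eqVneq w (N y)) => [-> _|//].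
    rewrite NK; apply: contraNneq xNy => MNy.
    by rewrite -[N y]MK MNy MK.
  exists x; first by rewrite !inE Nx.
  by rewrite !inE ffunE eqxx negbK.
Qed.

(** Every edge at a missed vertex ends in a covered one, and each covered vertex
    has at most one missed neighbour; so the missed vertices add at most [s] to
    the contribution [s * d] of the covered ones. *)
Lemma degree_sum_inessential d :
    {in W, forall x, degree_in r W x <= d} ->
    {in W, forall x, exists N, [/\ matching W N, #|covered N| = s & N x = x]} ->
  degree_sum r W <= s * d.+1.
Proof.
move=> dW iness.
have [->|[x0 x0W]] := set_0Vmem W; first by rewrite /degree_sum big_set0.
have [M [mM cM _]] := iness x0 x0W.
have sM : covered M \subset W.
  by apply/subsetP => x; rewrite inE; case/matchingP: mM => _ Mr /Mr[].
rewrite /degree_sum (big_setID (covered M)) /= (setIidPr sM) mulnS addnC.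
apply: leq_add; last first.
  rewrite -cM -sum_nat_const; apply: leq_sum => x /(subsetP sM).
  exact: dW.
rewrite -cM -sum1_card; rewrite /degree_in exchange_big /=.
rewrite (big_setID (covered M)) /= (setIidPr sM) [X in _ + X]big1 ?addn0.
  apply: leq_sum => t tM; have tW := subsetP sM _ tM.
  have [N [mN cN Nt]] := iness t tW.
  have [/existsP[u /andP[uU rut]]|] :=
    boolP [exists u, (u \in W :\: covered M) && r u t].
    rewrite (bigD1 u) //= big1 ?addn0 ?leq_b1 // => v /andP[vU vu].
    apply/eqP; rewrite eqb0; apply/negP => rvt.
    move: uU vU; rewrite !inE !negbK => /andP[/eqP Mu uW] /andP[Mv vW].
    have /negP[] // : M v != v.
    apply: (exposed_no_common_neighbor mM cM mN cN tW uW) => //.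
    - by rewrite r_sym.
    - by rewrite r_sym.
    - by rewrite eq_sym.
  move/existsPn=> no_u; rewrite big1 // => u uU.
  by have := no_u u; rewrite uU /= => /negPf->.
move=> y; rewrite !inE negbK => /andP[/eqP My yW].
rewrite big1 // => x; rewrite !inE negbK => /andP[/eqP Mx xW].
apply/eqP; rewrite eqb0; apply/negP => rxy.
by have := exposed_nonadjacent mM cM xW yW rxy Mx; rewrite My eqxx.
Qed.

End Maximum.

(** The bound e <= nu (Delta + 1), with both sides doubled.  Removing a vertex
    that lies on all maximum matchings lowers nu by one and destroys at most
    Delta edges; if there is no such vertex, [degree_sum_inessential] applies. *)
Lemma degree_sum_matching W d s :
    {in W, forall x, degree_in r W x <= d} ->
    (forall f, matching W f -> #|covered f| <= s.*2) ->
  degree_sum r W <= s.*2 * d.+1.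
Proof.
have [n] := ubnP #|W|; elim: n => // n IH in W s *.
rewrite ltnS => Wn dW max_s.
have [/existsP[v /andP[vW /forallP ess]]|iness] := boolP
  [exists v in W, [forall f, matching (W :\ v) f ==> (#|covered f| < s.*2)]].
  have sW : W :\ v \subset W by apply: subsetDl.
  case: s => [|s] in max_s ess *.
    have := ess [ffun x => x]; rewrite ltn0 implybF => /matchingP[].
    by split=> x; rewrite !ffunE // eqxx.
  have dW' : {in W :\ v, forall x, degree_in r (W :\ v) x <= d}.
    move=> x /(subsetP sW)/dW; apply: leq_trans; exact: degree_in_sub.
  have maxW' f : matching (W :\ v) f -> #|covered f| <= s.*2.
    move=> mf; have := implyP (ess f) mf.
    (* The number of covered vertices is even, so it drops by two. *)
    rewrite (card_covered mf); lia.
  have Wn' : #|W :\ v| < n by rewrite (cardsD1 v) vW in Wn.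
  have := IH _ _ Wn' dW' maxW'.
  have := degree_sum_sub r_sym sW dW.
  have -> : W :\: (W :\ v) = [set v].
    apply/setP => x; rewrite !inE; case: eqVneq => [->|] //=.
    by case: (x \in W).
  rewrite cards1; lia.
apply: (degree_sum_inessential max_s dW) => v vW.
have /forallPn[N] := exists_inPn iness v vW.
rewrite negb_imply -leqNgt => /andP[mN cN].
have mNW : matching W N := matchingS (subsetDl _ _) mN.
exists N; split=> //; first by apply/eqP; rewrite eqn_leq max_s.
apply/eqP/negPn/negP => Nv; case/matchingP: mN => _ /(_ v Nv)[].
by rewrite !inE eqxx.
Qed.

End Matchings.

(** * Colourings and the complement graph *)

Section Colourings.
Variable G : sgraph.
Implicit Types (W : {set G}) (x y : G).

Definition nonadj : rel G := fun x y => (x != y) && ~~ adj x y.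

Lemma nonadj_sym : symmetric nonadj.
Proof. by move=> x y; rewrite /nonadj eq_sym adj_sym. Qed.

Lemma nonadj_irr : irreflexive nonadj.
Proof. by move=> x; rewrite /nonadj eqxx. Qed.

Lemma degree_in_compl W x : x \in W ->
  degree_in (@adj G) W x + degree_in nonadj W x = #|W|.-1.
Proof.
move=> xW; rewrite [#|W|](cardsD1 x) xW /= -sum1_card /degree_in -big_split /=.
rewrite (bigD1 x) //= adj_irrefl nonadj_irr add0n.
apply: eq_big => y; first by rewrite !inE andbC.
by case/andP=> _ yx; rewrite /nonadj eq_sym yx; case: adj.
Qed.

Definition colorable_on c W :=
  [exists f : {ffun G -> 'I_c},
    [forall x in W, forall y in W, adj x y ==> (f x != f y)]].

Lemma colorable_onT c : colorable_on c [set: G] = colorable G c.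
Proof.
apply: eq_existsb => f; apply/idP/idP => /forallP fP.
  apply/forallP => x; apply/forallP => y.
  by have /forallP/(_ y) := implyP (fP x) (in_setT x); rewrite inE.
apply/forall_inP => x _; apply/forall_inP => y _.
exact: (forallP (fP x)).
Qed.

Lemma colorable_on_image c W (g : G -> G) :
    {in W &, forall x y, adj x y -> g x != g y} -> #|g @: W| <= c.+1 ->
  colorable_on c.+1 W.
Proof.
move=> g_proper g_im; apply/existsP.
pose s := enum (g @: W).
have small x : x \in W -> index (g x) s < c.+1.
  by move=> xW; rewrite (leq_trans _ g_im) // cardE index_mem mem_enum imset_f.
exists [ffun x => inord (index (g x) s)].
apply/forall_inP => x xW; apply/forall_inP => y yW; apply/implyP => xy.
rewrite !ffunE; apply: contraNneq (g_proper x y xW yW xy).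
move=> /(congr1 val) /=; rewrite !inordK ?small // => e.
have gs z : z \in W -> g z \in s by move=> zW; rewrite mem_enum imset_f.
by rewrite -(nth_index (g x) (gs x xW)) e nth_index ?gs.
Qed.

(** Colour the vertices by the pairs of the matching [f] of the complement and
    by the remaining single vertices: every vertex but the followers needs a
    colour of its own. *)
Lemma matching_colorable c W f : matching nonadj W f ->
  #|W| <= c.+1 + #|followers f| -> colorable_on c.+1 W.
Proof.
move=> /matchingP[fK fr] cW.
pose g x := if enum_rank (f x) < enum_rank x then f x else x.
have moved x : enum_rank (f x) < enum_rank x -> f x != x.
  by apply: contraTneq => ->; rewrite ltnn.
apply: (@colorable_on_image _ _ g) => [x y xW yW xy|].
  have xNy : x != y by apply: contraTneq xy => ->; rewrite adj_irrefl.
  have not_mate z t : adj z t -> f z != t.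
    move=> zt; apply: contraTneq zt => fz.
    have [->|fzz] := eqVneq z t; first by rewrite adj_irrefl.
    have [] := fr z; first by rewrite fz eq_sym.
    by rewrite fz => _ /andP[].
  rewrite /g; case: ifP => _; case: ifP => _ //.
  - by rewrite (inj_eq (inv_inj fK)).
  - exact: not_mate.
  - by rewrite eq_sym not_mate // adj_sym.
have sF : followers f \subset W.
  by apply/subsetP => x; rewrite inE => /moved/fr[].
apply: (@leq_trans #|W :\: followers f|); last by rewrite cardsDS //; lia.
apply/subset_leq_card/subsetP => _ /imsetP[x xW ->]; rewrite !inE /g.
have [lt|ge] := ltnP (enum_rank (f x)) (enum_rank x).
  have [//|-> _] := fr (f x); first by rewrite fK eq_sym moved.
  by rewrite fK ltnNge ltnW.
by rewrite xW ltnNge ge.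
Qed.

(** If [v] had no neighbour in some colour class of a colouring of [W :\ v], it
    could join that class; so [v] has at least [c] neighbours in [W]. *)
Lemma critical_degree c W v : v \in W ->
    colorable_on c (W :\ v) -> ~~ colorable_on c W ->
  degree_in nonadj W v + c < #|W|.
Proof.
move=> vW /existsP[f /forall_inP fP] nW.
have Wpos : 0 < #|W| by apply/card_gt0P; exists v.
suff cdeg : c <= degree_in (@adj G) W v.
  have := degree_in_compl vW; lia.
rewrite degree_inE -[X in X <= _]card_ord -cardsT.
suff -> : [set: 'I_c] = f @: [set y in W | adj v y] by apply: leq_imset_card.
apply/esym/eqP; rewrite eqEsubset subsetT /=; apply/subsetP => a _.
apply: contraR nW => a_free; apply/existsP.
have nbr y : y \in W -> adj v y -> a != f y.
  by move=> yW vy; apply: contraNneq a_free => ->; apply: imset_f; rewrite inE yW.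
exists [ffun x => if x == v then a else f x].
apply/forall_inP => x xW; apply/forall_inP => y yW; apply/implyP => xy.
rewrite !ffunE; case: (eqVneq x v) => [xv|xv]; case: (eqVneq y v) => [yv|yv].
- by rewrite xv yv adj_irrefl in xy.
- by apply: nbr => //; rewrite -xv.
- by rewrite eq_sym; apply: nbr => //; rewrite -yv adj_sym.
have := fP x; rewrite !inE xv xW => /(_ isT)/forall_inP/(_ y).
by rewrite !inE yv yW => /(_ isT)/implyP/(_ xy).
Qed.

(** The bound on the number of edges of the complement, doubled: pass to a
    minimal set [W'] of size [c.+2 + m'] that is not colourable.  Inside it both
    the maximum degree and the matching number of the complement are at most
    [m'], whence at most [m' * m'.+1] edges, and [m'.+1 <= d]. *)
Lemma nonadj_degree_sum c m d W :
    ~~ colorable_on c.+1 W -> #|W| = c.+2 + m ->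
    {in W, forall x, degree_in nonadj W x <= d} -> m < d ->
  degree_sum nonadj W <= (m * d).*2.
Proof.
move=> nW cW dW md.
have [W' /minsetP[nW' minW'] sW] :=
  minset_exists (P := fun A => ~~ colorable_on c.+1 A) nW.
have cardW' f : matching nonadj W' f -> c.+1 + #|followers f| < #|W'|.
  by move=> mf; rewrite ltnNge; apply: contra nW'; apply: matching_colorable.
(* The empty matching gives a lower bound on the size of W'. *)
have cW' : c.+1 < #|W'|.
  have /cardW' : matching nonadj W' [ffun x => x].
    by apply/matchingP; split=> x; rewrite !ffunE // eqxx.
  lia.
have [m' cardW'E] : exists m', #|W'| = c.+2 + m' by exists (#|W'| - c.+2); lia.
have dW' : {in W', forall x, degree_in nonadj W' x <= m'}.
  move=> x xW'; have : colorable_on c.+1 (W' :\ x).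
    apply: contraT => nx; have := minW' _ nx (subsetDl _ _).
    by move/setP/(_ x); rewrite !inE eqxx xW'.
  by move/(critical_degree xW')/(_ nW'); lia.
have nuW' f : matching nonadj W' f -> #|covered f| <= m'.*2.
  by move=> mf; rewrite (card_covered mf); have := cardW' f mf; lia.
have := degree_sum_matching nonadj_sym nonadj_irr dW' nuW'.
have := degree_sum_sub nonadj_sym sW dW.
rewrite cardsDS // cW cardW'E.
have := subset_leq_card sW; rewrite cW cardW'E => le.
have -> : c.+2 + m - (c.+2 + m') = m - m' by lia.
have m'm : m' <= m by lia.
have : m'.*2 * m'.+1 <= (m' * d).*2 by rewrite -doubleMl leq_double leq_mul2l; lia.
rewrite mulnBl; have : m' * d <= m * d by rewrite leq_mul2r m'm orbT.
lia.
Qed.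

(** Each edge comes from two ordered pairs of adjacent vertices. *)
Lemma card_edges : #|edges G|.*2 = degree_sum (@adj G) [set: G].
Proof.
pose P := [set p : G * G | adj p.1 p.2].
have -> : degree_sum (@adj G) [set: G] = #|P|.
  rewrite -sum1_card big_mkcond /= /degree_sum pair_big_dep /=.
  rewrite big_mkcond /=; apply: eq_bigr => -[x y] _; rewrite !inE /=.
  by case: (adj x y).
rewrite -[#|P|]sum1_card (partition_big (fun p => [set p.1; p.2]) (mem (edges G))) /=.
  rewrite (eq_bigr (fun _ => 2)) ?sum_nat_const ?muln2 // => A.
  rewrite inE => /existsP[x /existsP[y /andP[xy /eqP->]]].
  have xNy : x != y by apply: contraTneq xy => ->; rewrite adj_irrefl.
  rewrite sum1_card -[RHS](_ : #|[set (x, y); (y, x)]| = 2); last first.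
    by rewrite cards2 xpair_eqE (negPf xNy).
  apply: eq_card => -[a b]; rewrite !inE /= -!topredE /= !inE /= !xpair_eqE.
  apply/andP/idP => [[ab /eqP/setP e]|].
    have aNb : a != b by apply: contraTneq ab => ->; rewrite adj_irrefl.
    have := set21 a b; have := set22 a b; rewrite !e.
    by case/set2P=> eb; case/set2P=> ea; move: aNb; rewrite ea eb ?eqxx ?orbT.
  case/orP=> /andP[/eqP-> /eqP->]; first by rewrite eqxx.
  by rewrite adj_sym xy setUC eqxx.
move=> [x y]; rewrite !inE /= => xy.
by apply/existsP; exists x; apply/existsP; exists y; rewrite xy eqxx.
Qed.

(** Deleting the neighbours of [x] isolates [x], and some other vertex remains
    because there are more than [l] vertices. *)
Lemma vertex_connected_degree l x : vertex_connected l G ->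
  l <= degree_in (@adj G) [set: G] x.
Proof.
case=> lG conn; rewrite degree_inE leqNgt; apply/negP.
set S := [set y in [set: G] | adj x y] => Sl.
have xS : x \notin S by rewrite !inE adj_irrefl.
have [y] : exists y, y \notin x |: S.
  apply/existsP; apply: contraLR lG => /existsPn full; rewrite -leqNgt.
  rewrite -cardsT; apply: leq_trans Sl; rewrite -[_.+1]/(1 + _).
  have -> : [set: G] = x |: S by apply/setP => z; rewrite (negPn (full z)) inE.
  by rewrite cardsU1 xS.
rewrite in_setU1 negb_or => /andP[yx yS].
case/connectP: (conn S Sl (exist _ x xS) (exist _ y yS)) => -[|z p] /=.
  by move=> _ /(congr1 val) /= /eqP; rewrite (negPf yx).
case/andP=> xz _ _.
by have := valP z; rewrite !inE -[adj _ _]/(del_adj (exist _ x xS) z) xz.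
Qed.

End Colourings.

(** * The lower bound *)

Lemma mul_predn_bin2 n : n * n.-1 = 'C(n, 2).*2.
Proof.
elim: n => // n IH; rewrite binS bin1 doubleD -IH /=.
by case: n {IH} => //= n; nia.
Qed.

(** The arithmetic of complementation, with [e] and [h] standing for the number
    of edges of the graph and for the degree sum of its complement. *)
Lemma edge_bound_from_complement c l m n Ck Cm e h :
    l <= c -> m < l -> n = c.+2 + m ->
    c.+2 * c.+1 = Ck.*2 -> m * m.-1 = Cm.*2 ->
    h <= (m * (n.-1 - l)).*2 -> e.*2 + h = n * n.-1 ->
  Ck + Cm + m * (l - (m - 1)) <= e.
Proof.
move=> lc ml nE; have [q cE] : exists q, c = l + q by exists (c - l); lia.
have [p lE] : exists p, l = m + p by exists (l - m); lia.
have nE1 : n.-1 = m + p + q + m + 1 by lia.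
have -> : n.-1 - l = q + m + 1 by lia.
rewrite nE1 nE cE lE; case: m {ml nE nE1 cE lE} => [|m]; first by rewrite !mul0n; lia.
have -> : m.+1 + p - (m.+1 - 1) = p.+1 by lia.
rewrite /=; lia.
Qed.

Lemma card_edges_lower_bound (G : sgraph) n k l :
    k <= n -> l < k - 1 -> n - k < l ->
    #|G| = n -> chromatic_number G = k -> vertex_connected l G ->
  'C(k, 2) + 'C(n - k, 2) + (n - k) * (l - (n - k - 1)) <= #|edges G|.
Proof.
move=> kn lk nkl cG chi conn.
have [c kE] : exists c, k = c.+2 by exists (k - 2); lia.
have ncol : ~~ colorable_on c.+1 [set: G].
  rewrite colorable_onT; apply/negP => col; move: chi; rewrite /chromatic_number.
  by case: ex_minnP => j _ /(_ _ col); lia.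
have [m mE] : exists m, n = k + m by exists (n - k); lia.
have cGT : #|[set: G]| = c.+2 + m by rewrite cardsT cG mE kE.
have deg x : degree_in (@adj G) [set: G] x + degree_in (@nonadj G) [set: G] x = n.-1.
  by rewrite degree_in_compl // cardsT cG.
have dH : {in [set: G], forall x, degree_in (@nonadj G) [set: G] x <= n.-1 - l}.
  by move=> x _; have := deg x; have := vertex_connected_degree x conn; lia.
have := nonadj_degree_sum ncol cGT dH.
have : degree_sum (@adj G) [set: G] + degree_sum (@nonadj G) [set: G] = n * n.-1.
  rewrite /degree_sum -big_split /= (eq_bigr (fun _ => n.-1)) //.
  by rewrite sum_nat_const cardsT cG.
rewrite -card_edges => total bound.
have -> : n - k = m by lia.
have md : m < n.-1 - l by lia.
apply: (@edge_bound_from_complement c _ _ n _ _ _ _ _ _ _ _ _ (bound md) total);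
  try lia.
- by rewrite -mul_predn_bin2 kE.
- by rewrite mul_predn_bin2.
Qed.

(** * The extremal graphs *)

Section ExtremalGraph.
Variables (k m d : nat).
Hypothesis dm_k : d + m < k.

(** Vertices [x < d] of the large clique are common neighbours of the small
    clique; [d + i] is the private neighbour of its vertex [i]. *)
Definition attached (x i : nat) := (x < d) || (x == d + i).

Definition extremal_adj : rel ('I_k + 'I_m) := fun u v =>
  match u, v with
  | inl x, inl y => x != y
  | inr i, inr j => i != j
  | inl x, inr i | inr i, inl x => attached x i
  end.

Fact extremal_adj_sym : symmetric extremal_adj.
Proof. by move=> [x|i] [y|j] //=; rewrite eq_sym. Qed.

Fact extremal_adj_irr : irreflexive extremal_adj.
Proof. by move=> [x|i] /=; rewrite eqxx. Qed.

Definition extremal_graph := SGraph extremal_adj_sym extremal_adj_irr.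

Lemma card_extremal : #|extremal_graph| = k + m.
Proof. by rewrite card_sum !card_ord. Qed.

(** The vertex [i] of the small clique takes the colour of vertex [d + i.+1] of
    the large one, which is neither a common nor its private neighbour. *)
Lemma chromatic_extremal : chromatic_number extremal_graph = k.
Proof.
rewrite /chromatic_number; case: ex_minnP => c /existsP[f fP] c_min.
apply/eqP; rewrite eqn_leq; apply/andP; split.
  apply: c_min; apply/existsP.
  have shift_lt (i : 'I_m) : d + i.+1 < k by have := ltn_ord i; lia.
  exists [ffun u : extremal_graph =>
    match u with inl x => x | inr i => Ordinal (shift_lt i) end].
  apply/forallP => u; apply/forallP => v; apply/implyP; rewrite !ffunE.
  rewrite /adj /=; case: u => [x|i]; case: v => [y|j] //=;
    rewrite /attached -val_eqE /=; try lia.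
  by rewrite -!val_eqE /=; lia.
have inj_f : injective (fun x : 'I_k => f (inl x)).
  move=> x y; apply: contra_eq => xy.
  exact: (implyP (forallP (forallP fP (inl x)) (inl y)) xy).
by have := leq_card _ inj_f; rewrite !card_ord.
Qed.

(** A vertex of the small clique reaches the large one along [d + m] paths that
    are disjoint apart from their origin: one through each common neighbour, and
    one through each vertex [j] of the small clique and its private neighbour
    [d + j].  Fewer than [d + m] deleted vertices leave one of them intact, and
    what is left of the large clique is connected. *)
Lemma vertex_connected_extremal : vertex_connected (d + m) extremal_graph.
Proof.
split=> [|S Sl]; first by rewrite card_extremal; lia.
pose G := del_vertices S.
have inl_inl (x y : G) : (exists a b, val x = inl a /\ val y = inl b) ->
    connect (@adj G) x y.
  case=> a [b [xa yb]]; have [->|xy] := eqVneq x y; first exact: connect0.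
  apply: connect1; rewrite /adj /= /del_adj xa yb /=.
  by apply: contraNneq xy => ab; apply/eqP/val_inj; rewrite xa yb ab.
have to_inl (x : G) : exists2 y : G, (exists a, val y = inl a) &
    connect (@adj G) x y.
  case xE : (val x) => [a|i]; first by exists x; [exists a|exact: connect0].
  (* The index of the path on which u lies. *)
  pose code (u : 'I_k + 'I_m) :=
    match u with inl a => a : nat | inr j => d + j end.
  have [p pl pS] : exists2 p, p < d + m & forall u, u \in S -> code u != p.
    have [p pS] : exists p : 'I_(d + m),
        p \notin [set p : 'I_(d + m) | [exists u in S, code u == p]].
      apply/existsP; apply: contraLR Sl => /existsPn full; rewrite -leqNgt.
      pose pr := fun u : 'I_k + 'I_m => insub (code u) : option 'I_(d + m).
      have sub : Some @: [set: 'I_(d + m)] \subset pr @: S.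
        apply/subsetP => _ /imsetP[p _ ->]; have := full p; rewrite negbK inE.
        case/exists_inP=> u uS /eqP up; apply/imsetP; exists u => //.
        by rewrite /pr up valK.
      have := leq_trans (subset_leq_card sub) (leq_imset_card _ _).
      by rewrite card_imset ?cardsT ?card_ord //; apply: Some_inj.
    exists p; first exact: ltn_ord.
    move=> u uS; apply: contraNneq pS => up; rewrite inE.
    by apply/exists_inP; exists u => //; apply/eqP.
  have pk : p < k by lia.
  have aS : inl (Ordinal pk) \notin S by apply/negP => /pS /=; rewrite eqxx.
  exists (exist _ (inl (Ordinal pk)) aS : G); first by exists (Ordinal pk).
  have [pd|dp] := ltnP p d.
    by apply: connect1; rewrite /adj /= /del_adj xE /= /attached pd.
  have jm : p - d < m by lia.
  have jS : inr (Ordinal jm) \notin S.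
    by apply/negP => /pS /=; rewrite subnKC // eqxx.
  apply: (@connect_trans _ _ (exist _ (inr (Ordinal jm)) jS : G)).
    have [ij|ij] := eqVneq i (Ordinal jm).
      rewrite (_ : x = exist _ (inr (Ordinal jm)) jS) ?connect0 //.
      by apply: val_inj; rewrite /= xE ij.
    by apply: connect1; rewrite /adj /= /del_adj xE.
  apply: connect1; rewrite /adj /= /del_adj /= /attached /=.
  by apply/orP; right; apply/eqP; lia.
move=> x y; have [x' [a xa] cx] := to_inl x; have [y' [b yb] cy] := to_inl y.
apply: connect_trans cx _; apply: (@connect_trans _ _ y').
  by apply: inl_inl; exists a, b.
have sym := sym_connect_sym (@adj_sym G).
by rewrite sym.
Qed.

Lemma card_edges_extremal :
  #|edges extremal_graph| = 'C(k, 2) + 'C(m, 2) + m * d.+1.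
Proof.
have clique n : \sum_(x < n) \sum_(y < n) (x != y : nat) = 'C(n, 2).*2.
  rewrite -mul_predn_bin2 (eq_bigr (fun=> n.-1)) ?sum_nat_const ?card_ord // => x _.
  by rewrite -big_mkcond sum1_card (eq_card (B := predC1 x)) ?cardC1 ?card_ord // => y;
    rewrite !inE eq_sym.
have cross (i : 'I_m) : \sum_(x < k) (attached x i : nat) = d.+1.
  have di : d + i < k by have := ltn_ord i; lia.
  rewrite (eq_bigr (fun x : 'I_k => (x < d) + (x == Ordinal di :> 'I_k)))
    => [|x _]; last first.
    by rewrite /attached -val_eqE /=; lia.
  rewrite big_split /= -big_mkcond /= -(big_ord_widen k (fun=> 1)); last by lia.
  rewrite sum_nat_const card_ord (bigD1 (Ordinal di)) //= eqxx big1 ?addn0; first by lia.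
  by move=> x /negPf->.
apply: double_inj; rewrite card_edges degree_sumT big_sumType /=.
under eq_bigr do rewrite big_sumType /=.
under [X in _ + X]eq_bigr do rewrite big_sumType /=.
rewrite !big_split /= !clique [X in _ + X + _]exchange_big /=.
by rewrite (eq_bigr (fun=> d.+1) (fun i _ => cross i)) sum_nat_const card_ord; lia.
Qed.

End ExtremalGraph.

(** * The theorem *)

Theorem theorem1p8 (n k l : nat) (hkn : k <= n) (hlk : l < k - 1) (hl : 1 < l)
    (hnk : n - k < l) :
  (forall G : sgraph,
      #|G| = n -> chromatic_number G = k -> vertex_connected l G ->
      'C(k, 2) + 'C(n - k, 2) + (n - k) * (l - (n - k - 1)) <= #|edges G|) /\
  (exists G : sgraph,
      [/\ #|G| = n, chromatic_number G = k, vertex_connected l G &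
          #|edges G| = 'C(k, 2) + 'C(n - k, 2) + (n - k) * (l - (n - k - 1))]).
Proof.
split; first by move=> G; apply: card_edges_lower_bound.
have dm_k : (l - (n - k)) + (n - k) < k by lia.
exists (extremal_graph k (n - k) (l - (n - k))); split.
- by rewrite card_extremal; lia.
- exact: chromatic_extremal.
- by have := vertex_connected_extremal dm_k; rewrite subnK // ltnW.
- rewrite card_edges_extremal //; congr (_ + _).
  by case: (n - k) hnk => // m ?; congr (_ * _); lia.
Qed.
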